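(* The proof systems $\mathsf{G3iSL}_\Box$, $\mathsf{G3iSL}^a_\Box$, $\mathsf{G3iSL}^4_\Box$, $\mathsf{G4iSL}_\Box$, $\mathsf{G4iSL}'_\Box$, $\mathsf{G4iSL}^a_\Box$, $\mathsf{G3iGLC}_\Box$, $\mathsf{iHSL}_\Box$ and $\mathsf{iHGLC}_\Box$ are all equivalent.
   Context: Formulas are built from the constant $\bot$, atoms (propositional variables) $p,q,r,\dots$, binary connectives $\wedge,\vee,\to$ and the unary modal operator $\Box$ (there is no $\Diamond$); $\neg\varphi$ abbreviates $\varphi\to\bot$; $\bot$ is not an atom. A sequent is an expression $\Gamma\Rightarrow\Delta$ with $\Gamma,\Delta$ finite multisets of formulas, $\Delta$ containing at most one formula. $\Gamma,\Pi$ denotes multiset union. $\Box\Gamma$ is the multiset $\{\Box\varphi\mid\varphi\in\Gamma\}$ and $\boxdot\Gamma=\Gamma\cup\Box\Gamma$ (multiset union). A formula is boxed if it has the form $\Box\psi$. Below, $\Pi$ ranges over finite multisets without boxed formulas, while $\Sigma,\Gamma$ are arbitrary. Common axioms and rules (''from premises infer conclusion''): At: $\Gamma,p\Rightarrow p$ ($p$ an atom). $L\bot$: $\Gamma,\bot\Rightarrow\Delta$. $R\wedge$: from $\Gamma\Rightarrow\varphi$ and $\Gamma\Rightarrow\psi$ infer $\Gamma\Rightarrow\varphi\wedge\psi$. $L\wedge$: from $\Gamma,\varphi,\psi\Rightarrow\Delta$ infer $\Gamma,\varphi\wedge\psi\Rightarrow\Delta$. $R\vee$: from $\Gamma\Rightarrow\varphi_i$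 ($i=0$ or $1$) infer $\Gamma\Rightarrow\varphi_0\vee\varphi_1$. $L\vee$: from $\Gamma,\varphi\Rightarrow\Delta$ and $\Gamma,\psi\Rightarrow\Delta$ infer $\Gamma,\varphi\vee\psi\Rightarrow\Delta$. $R{\to}$: from $\Gamma,\varphi\Rightarrow\psi$ infer $\Gamma\Rightarrow\varphi\to\psi$. $\mathsf{G3im}$ = common axioms and rules plus $L{\to}$: from $\Gamma,\varphi\to\psi\Rightarrow\varphi$ and $\Gamma,\psi\Rightarrow\Delta$ infer $\Gamma,\varphi\to\psi\Rightarrow\Delta$. $\mathsf{G4im}$ = common axioms and rules plus $Lp{\to}$: from $\Gamma,p,\varphi\Rightarrow\Delta$ infer $\Gamma,p,p\to\varphi\Rightarrow\Delta$ ($p$ an atom); $L{\wedge}{\to}$: from $\Gamma,\varphi\to(\psi\to\gamma)\Rightarrow\Delta$ infer $\Gamma,\varphi\wedge\psi\to\gamma\Rightarrow\Delta$; $L{\vee}{\to}$: from $\Gamma,\varphi\to\gamma,\psi\to\gamma\Rightarrow\Delta$ infer $\Gamma,\varphi\vee\psi\to\gamma\Rightarrow\Delta$; $L{\to}{\to}$: from $\Gamma,\psi\to\gamma\Rightarrow\varphi\to\psi$ and $\Gamma,\gamma\Rightarrow\Delta$ infer $\Gamma,(\varphi\to\psi)\to\gamma\Rightarrow\Delta$. Modal rules: $\mathcal R_{\rm SL}$: from $\Pi,\boxdot\Gamma,\Box\varphi\Rightarrow\varphi$ infer $\Box\Sigma,\Pi,\Box\Gamma\Rightarrow\Box\varphi$.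 $\mathcal R^4_{\rm SL}$: from $\Pi,\boxdot\Gamma,\Box\varphi\Rightarrow\varphi$ infer $\Pi,\Box\Gamma\Rightarrow\Box\varphi$. $\mathcal R^{4a}_{\rm SL}$: from $\Sigma,\boxdot\Gamma,\Box\varphi\Rightarrow\varphi$ infer $\Sigma,\Box\Gamma\Rightarrow\Box\varphi$ (no restriction on $\Sigma$). $\to_{\rm SL}$: from $\Pi,\boxdot\Gamma,\Box\varphi,\Box\varphi\to\psi\Rightarrow\varphi$ and $\Pi,\Box\Gamma,\psi\Rightarrow\Delta$ infer $\Pi,\Box\Gamma,\Box\varphi\to\psi\Rightarrow\Delta$. $\mathcal R_{\rm GL}$: from $\boxdot\Gamma,\Box\varphi\Rightarrow\varphi$ infer $\Sigma,\Box\Gamma\Rightarrow\Box\varphi$. $L\Box$: from $\Gamma,\Box\varphi\Rightarrow\Delta$ infer $\Gamma,\varphi\Rightarrow\Delta$. Sequent calculi: $\mathsf{G3iSL}_\Box=\mathsf{G3im}+\mathcal R_{\rm SL}$; $\mathsf{G3iSL}^4_\Box=\mathsf{G3im}+\mathcal R^4_{\rm SL}$; $\mathsf{G3iSL}^a_\Box=\mathsf{G3im}+\mathcal R^{4a}_{\rm SL}$; $\mathsf{G4iSL}_\Box=\mathsf{G4im}+{\to_{\rm SL}}+\mathcal R^4_{\rm SL}$; $\mathsf{G4iSL}^a_\Box=\mathsf{G4im}+{\to_{\rm SL}}+\mathcal R^{4a}_{\rm SL}$; $\mathsf{G4iSL}'_\Box$ is $\mathsf{G4iSL}_\Box$ with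 $L{\to}{\to}$ replaced by $L{\to}{\to}'$: from $\Gamma,\psi\to\gamma,\varphi\Rightarrow\psi$ and $\Gamma,\gamma\Rightarrow\Delta$ infer $\Gamma,(\varphi\to\psi)\to\gamma\Rightarrow\Delta$; $\mathsf{G3iGLC}_\Box=\mathsf{G3im}+\mathcal R_{\rm GL}+L\Box$. Hilbert systems: $\mathsf{iK}_\Box$ is a standard Hilbert system for intuitionistic propositional logic (in the modal language, with modus ponens) extended by the axiom scheme $\Box(\varphi\to\psi)\to(\Box\varphi\to\Box\psi)$ and the necessitation rule (from $\vdash\varphi$ infer $\vdash\Box\varphi$). $\mathsf{iHSL}_\Box$ is $\mathsf{iK}_\Box$ plus the axiom scheme $(\Box\varphi\to\varphi)\to\varphi$. $\mathsf{iHGLC}_\Box$ is $\mathsf{iK}_\Box$ plus the axiom schemes $\Box(\Box\varphi\to\varphi)\to\Box\varphi$ and $\varphi\to\Box\varphi$. Equivalence: two sequent calculi are equivalent if they derive the same sequents; a Hilbert system is equivalent to a sequent calculus if for every formula $\varphi$, $\varphi$ is provable in the Hilbert system if and only if the sequent $(\ \Rightarrow\varphi)$ is derivable in the sequent calculus; two Hilbert systems are equivalent if they prove the same formulas. *)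

(* Defs.v *)
From HB Require Import structures.
From mathcomp Require Import all_boot.
From mathcomp Require Import finmap multiset.

Set Implicit Arguments.
Unset Strict Implicit.
Unset Printing Implicit Defensive.

Local Open Scope mset_scope.

Inductive form : Type :=
| Bot
| Atom of nat
| And of form & form
| Or of form & form
| Imp of form & form
| Box of form.

(* [{mset form}] needs a choiceType, obtained by an encoding into trees. *)
Fixpoint form_encode (A : form) : GenTree.tree nat :=
  match A with
  | Bot => GenTree.Node 0 [::]
  | Atom p => GenTree.Leaf p
  | And A B => GenTree.Node 1 [:: form_encode A; form_encode B]
  | Or A B => GenTree.Node 2 [:: form_encode A; form_encode B]
  | Imp A B => GenTree.Node 3 [:: form_encode A; form_encode B]
  | Box A => GenTree.Node 4 [:: form_encode A]
  end.

Fixpoint form_decode (t : GenTree.tree nat) : option form :=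
  match t with
  | GenTree.Leaf p => Some (Atom p)
  | GenTree.Node 0 [::] => Some Bot
  | GenTree.Node 1 [:: t; u] =>
      if (form_decode t, form_decode u) is (Some A, Some B)
      then Some (And A B) else None
  | GenTree.Node 2 [:: t; u] =>
      if (form_decode t, form_decode u) is (Some A, Some B)
      then Some (Or A B) else None
  | GenTree.Node 3 [:: t; u] =>
      if (form_decode t, form_decode u) is (Some A, Some B)
      then Some (Imp A B) else None
  | GenTree.Node 4 [:: t] => omap Box (form_decode t)
  | _ => None
  end.

Lemma form_encodeK : pcancel form_encode form_decode.
Proof. by elim=> //= [A -> B ->|A -> B ->|A -> B ->|A ->]. Qed.

HB.instance Definition _ := Countable.copy form (pcan_type form_encodeK).

Definition boxed (A : form) : bool := if A is Box _ then true else false.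

Definition unboxed (P : {mset form}) : Prop := {in P, forall A, ~~ boxed A}.

Definition boxm (G : {mset form}) : {mset form} :=
  seq_mset [seq Box A | A <- G].

Definition boxdot (G : {mset form}) : {mset form} := G `+` boxm G.

(* The multiset of at most one formula on the right is an [option]. *)
Definition sequent : Type := ({mset form} * option form)%type.

Notation "G =>> D" := ((G, D) : sequent) (at level 70, no associativity).

(* A calculus is the set of its rule instances: [C ps c] says that [c] may be
   inferred from the premises [ps]; axioms have no premises. *)
Definition calculus : Type := seq sequent -> sequent -> Prop.

Definition calcU (C D : calculus) : calculus := fun ps c => C ps c \/ D ps c.

Notation "C :+: D" := (calcU C D) (at level 50, left associativity).

Inductive derivable (C : calculus) : sequent -> Prop :=
| Infer ps c :
    C ps c -> (forall s, s \in ps -> derivable C s) -> derivable C c.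

Implicit Types (G S P : {mset form}) (D : option form) (A B E : form).

Inductive common : calculus :=
| At G p : common [::] (Atom p +` G =>> Some (Atom p))
| LBot G D : common [::] (Bot +` G =>> D)
| RAnd G A B :
    common [:: G =>> Some A; G =>> Some B] (G =>> Some (And A B))
| LAnd G A B D :
    common [:: A +` (B +` G) =>> D] (And A B +` G =>> D)
| ROr1 G A B : common [:: G =>> Some A] (G =>> Some (Or A B))
| ROr2 G A B : common [:: G =>> Some B] (G =>> Some (Or A B))
| LOr G A B D :
    common [:: A +` G =>> D; B +` G =>> D] (Or A B +` G =>> D)
| RImp G A B : common [:: A +` G =>> Some B] (G =>> Some (Imp A B)).

Inductive LImp : calculus :=
| LImp_intro G A B D :
    LImp [:: Imp A B +` G =>> Some A; B +` G =>> D] (Imp A B +` G =>> D).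

Inductive LAtomImp : calculus :=
| LAtomImp_intro G p A D :
    LAtomImp [:: Atom p +` (A +` G) =>> D]
             (Atom p +` (Imp (Atom p) A +` G) =>> D).

Inductive LAndImp : calculus :=
| LAndImp_intro G A B E D :
    LAndImp [:: Imp A (Imp B E) +` G =>> D] (Imp (And A B) E +` G =>> D).

Inductive LOrImp : calculus :=
| LOrImp_intro G A B E D :
    LOrImp [:: Imp A E +` (Imp B E +` G) =>> D] (Imp (Or A B) E +` G =>> D).

Inductive LImpImp : calculus :=
| LImpImp_intro G A B E D :
    LImpImp [:: Imp B E +` G =>> Some (Imp A B); E +` G =>> D]
            (Imp (Imp A B) E +` G =>> D).

Inductive LImpImp' : calculus :=
| LImpImp'_intro G A B E D :
    LImpImp' [:: Imp B E +` (A +` G) =>> Some B; E +` G =>> D]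
             (Imp (Imp A B) E +` G =>> D).

Inductive R_SL : calculus :=
| R_SL_intro S P G A : unboxed P ->
    R_SL [:: P `+` boxdot G `+` [mset Box A] =>> Some A]
         (boxm S `+` P `+` boxm G =>> Some (Box A)).

Inductive R4_SL : calculus :=
| R4_SL_intro P G A : unboxed P ->
    R4_SL [:: P `+` boxdot G `+` [mset Box A] =>> Some A]
          (P `+` boxm G =>> Some (Box A)).

Inductive R4a_SL : calculus :=
| R4a_SL_intro S G A :
    R4a_SL [:: S `+` boxdot G `+` [mset Box A] =>> Some A]
           (S `+` boxm G =>> Some (Box A)).

Inductive Imp_SL : calculus :=
| Imp_SL_intro P G A B D : unboxed P ->
    Imp_SL [:: P `+` boxdot G `+` [mset Box A] `+` [mset Imp (Box A) B]
                 =>> Some A;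
               P `+` boxm G `+` [mset B] =>> D]
           (P `+` boxm G `+` [mset Imp (Box A) B] =>> D).

Inductive R_GL : calculus :=
| R_GL_intro S G A :
    R_GL [:: boxdot G `+` [mset Box A] =>> Some A]
         (S `+` boxm G =>> Some (Box A)).

Inductive LBox : calculus :=
| LBox_intro G A D : LBox [:: Box A +` G =>> D] (A +` G =>> D).

Definition G3im : calculus := common :+: LImp.

(* G4im without its rule for left implications with an implication as
   antecedent, of which there are two versions. *)
Definition G4im_base : calculus := common :+: LAtomImp :+: LAndImp :+: LOrImp.

Definition G4im : calculus := G4im_base :+: LImpImp.

Definition G3iSL : calculus := G3im :+: R_SL.
Definition G3iSL4 : calculus := G3im :+: R4_SL.
Definition G3iSLa : calculus := G3im :+: R4a_SL.
Definition G4iSL : calculus := G4im :+: Imp_SL :+: R4_SL.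
Definition G4iSLa : calculus := G4im :+: Imp_SL :+: R4a_SL.
Definition G4iSL' : calculus := G4im_base :+: LImpImp' :+: Imp_SL :+: R4_SL.
Definition G3iGLC : calculus := G3im :+: R_GL :+: LBox.

Definition axioms : Type := form -> Prop.

Inductive iK_axiom : axioms :=
| ax_k A B : iK_axiom (Imp A (Imp B A))
| ax_s A B E :
    iK_axiom (Imp (Imp A (Imp B E)) (Imp (Imp A B) (Imp A E)))
| ax_and_elim1 A B : iK_axiom (Imp (And A B) A)
| ax_and_elim2 A B : iK_axiom (Imp (And A B) B)
| ax_and_intro A B : iK_axiom (Imp A (Imp B (And A B)))
| ax_or_intro1 A B : iK_axiom (Imp A (Or A B))
| ax_or_intro2 A B : iK_axiom (Imp B (Or A B))
| ax_or_elim A B E :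
    iK_axiom (Imp (Imp A E) (Imp (Imp B E) (Imp (Or A B) E)))
| ax_bot_elim A : iK_axiom (Imp Bot A)
| ax_box_imp A B : iK_axiom (Imp (Box (Imp A B)) (Imp (Box A) (Box B))).

Inductive SL_axiom : axioms :=
| ax_SL A : SL_axiom (Imp (Imp (Box A) A) A).

Inductive GLC_axiom : axioms :=
| ax_GL A : GLC_axiom (Imp (Box (Imp (Box A) A)) (Box A))
| ax_C A : GLC_axiom (Imp A (Box A)).

(* A Hilbert system is given by the set of all instances of its axiom schemes;
   its rules are always modus ponens and necessitation. *)
Inductive provable (Ax : axioms) : form -> Prop :=
| prov_ax A : Ax A -> provable Ax A
| prov_mp A B : provable Ax (Imp A B) -> provable Ax A -> provable Ax B
| prov_nec A : provable Ax A -> provable Ax (Box A).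

Definition iHSL : axioms := fun A => iK_axiom A \/ SL_axiom A.
Definition iHGLC : axioms := fun A => iK_axiom A \/ GLC_axiom A.

Inductive proof_system : Type :=
| Gentzen of calculus
| Hilbert of axioms.

Definition equivalent (X Y : proof_system) : Prop :=
  match X, Y with
  | Gentzen C, Gentzen C' => forall s, derivable C s <-> derivable C' s
  | Gentzen C, Hilbert Ax | Hilbert Ax, Gentzen C =>
      forall A, provable Ax A <-> derivable C (mset0 =>> Some A)
  | Hilbert Ax, Hilbert Ax' => forall A, provable Ax A <-> provable Ax' A
  end.

(* Main.v *)
Require Import Defs.
From mathcomp Require Import all_boot.
From mathcomp Require Import finmap multiset zify.
From Stdlib Require List.
From Stdlib Require Import Classical.

(* Every system is sound and complete for Kripke models with an intuitionistic
   preorder [le] and a modal relation [acc] contained in [le], stable under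
   [le] on the left and conversely well-founded.

   For cut-free completeness the worlds are unprovable multisets over the boxed
   subformulas of the end sequent that cannot be replaced by a lighter
   unprovable multiset with the same consequences; a modal step adds a boxed
   formula, so it is conversely well-founded. The same truth lemma serves the
   weakest G3 calculus, G3iSL4, and the weakest G4 calculus, G4iSL'; only the
   treatment of implications on the left differs. *)

Set Implicit Arguments.
Unset Strict Implicit.
Unset Printing Implicit Defensive.

Local Open Scope mset_scope.

Implicit Types (G S P H : {mset form}) (D : option form) (A B E : form)
  (C : calculus) (s : sequent) (ps : seq sequent).

(** Validity mediates between cut-free calculi and Hilbert systems, whose modus ponens is a cut, so
    no cut elimination is needed.

    The obstacle is that saturation usually enlarges a context, while the left rules of G4im consume
    their principal formula. Contexts are therefore driven down in weight. If all premises of a left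
    rule for a formula are lighter and have at least the same consequences, that formula cannot
    occur in a minimal context, since otherwise the premises would be derivable and the rule would
    derive the sequent. For the other implications in a context it suffices that no world forces
    their antecedent.

    Soundness needs no second model construction for weak rules: [G4iSL'] and [G4iSL] embed into
    [G4iSLa], and [G3iSL4] into [G3iSLa]. The Hilbert systems become complete because derivations in
    [G3iSL4] translate into [iHSL], whose theorems [iHGLC] proves. *)

Ltac mset_ac := apply/msetP=> ?; rewrite !msetE2; lia.

Lemma mem_seq_mset (T : choiceType) (r : seq T) : seq_mset r =i r.
Proof. exact: perm_mem (perm_eq_seq_mset r). Qed.

Lemma mem_mset_split (T : choiceType) (x : T) (X : {mset T}) :
  x \in X -> exists Y : {mset T}, X = x +` Y.
Proof. by move=> /msetB1K <-; exists (X `\ x). Qed.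

Lemma forall_mem2 (Q : sequent -> Prop) s1 s2 :
  (forall s, s \in [:: s1; s2] -> Q s) -> Q s1 /\ Q s2.
Proof. by move=> h; split; apply: h; rewrite !inE eqxx ?orbT. Qed.

Lemma forall_mem1 (Q : sequent -> Prop) s1 :
  (forall s, s \in [:: s1] -> Q s) -> Q s1.
Proof. by apply; rewrite inE. Qed.

Arguments forall_mem1 {Q s1} _.
Arguments forall_mem2 {Q s1 s2} _.

(** * Boxed multisets *)

Lemma Box_inj : injective Box. Proof. by move=> A B [->]. Qed.

Lemma boxmE G A : (boxm G) (Box A) = G A.
Proof.
rewrite /boxm mset_seqE -[RHS]count_mem_mset count_map.
by apply: eq_count => B /=; apply: (inj_eq Box_inj).
Qed.

Lemma mem_boxm G A : (Box A \in boxm G) = (A \in G).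
Proof. by rewrite mem_seq_mset (mem_map Box_inj). Qed.

Lemma boxmP G A : A \in boxm G -> exists2 B, A = Box B & B \in G.
Proof. by rewrite mem_seq_mset => /mapP[B BG ->]; exists B. Qed.

Lemma boxm_unboxed G A : ~~ boxed A -> (boxm G) A = 0.
Proof.
by move=> nA; apply/mset_eq0P; apply/negP => /boxmP[B eA]; rewrite eA in nA.
Qed.

Lemma boxmD G H : boxm (G `+` H) = boxm G `+` boxm H.
Proof.
apply/msetP=> A; rewrite msetE2; case: (boolP (boxed A)) => [|nA].
  by case: A => // A _; rewrite !boxmE msetE2.
by rewrite !boxm_unboxed.
Qed.

Lemma boxm1 A : boxm [mset A] = [mset Box A].
Proof.
rewrite /boxm enum_msetn /= mset_cons; apply/msetP=> B.
by rewrite msetE2 mset_seqE addn0.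
Qed.

Lemma boxm0 : boxm mset0 = mset0.
Proof. by apply/msetP=> B; rewrite /boxm enum_mset0 mset_seqE mset0E. Qed.

Lemma boxdotD G H : boxdot (G `+` H) = boxdot G `+` boxdot H.
Proof. by rewrite /boxdot boxmD; mset_ac. Qed.

Lemma unboxedD P H : unboxed P -> unboxed H -> unboxed (P `+` H).
Proof. by move=> uP uH A; rewrite in_msetD => /orP[/uP|/uH]. Qed.

Lemma unboxed1 A : ~~ boxed A -> unboxed [mset A].
Proof. by move=> nA B; rewrite in_mset1 => /eqP ->. Qed.

Lemma unboxed0 : unboxed mset0.
Proof. by move=> A; rewrite in_mset0. Qed.

(** Brings an arbitrary context into the shape that [R4_SL] and [Imp_SL] require of their
    conclusions. *)
Lemma boxm_split G :
  exists P H, unboxed P /\ G = P `+` boxm H.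
Proof.
rewrite -(seq_mset_id G); elim: (_ G) => {G} [|A r [P [H [uP eq_r]]]].
  exists mset0, mset0; split; first exact: unboxed0.
  by rewrite boxm0; apply/msetP=> B; rewrite msetE2 !mset0E mset_seqE.
rewrite mset_cons eq_r; case: (boolP (boxed A)) => [|nA].
  case: A => // A _; exists P, (A +` H); split=> //.
  by rewrite boxmD boxm1; mset_ac.
exists (A +` P), H; split; last by mset_ac.
exact/unboxedD/uP/unboxed1.
Qed.

(** * Kripke models *)

(** [acc_le] validates the scheme $\varphi\to\Box\varphi$, [acc_wf] Löb's scheme, and [le_acc] makes
    boxed formulas persistent. Transitivity of [acc] follows from [acc_le] and [le_acc]. *)
Record model := Model {
  world :> Type;
  le : world -> world -> Prop;
  acc : world -> world -> Prop;
  val : nat -> world -> Prop;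
  le_refl : forall w, le w w;
  le_tr : forall u v w, le u v -> le v w -> le u w;
  acc_le : forall v w, acc v w -> le v w;
  le_acc : forall u v w, le u v -> acc v w -> acc u w;
  acc_wf : well_founded (fun v w => acc w v);
  val_mono : forall p v w, le v w -> val p v -> val p w }.

Fixpoint forces (M : model) (w : M) A : Prop :=
  match A with
  | Bot => False
  | Atom p => val p w
  | And A B => forces w A /\ forces w B
  | Or A B => forces w A \/ forces w B
  | Imp A B => forall v, le w v -> forces v A -> forces v B
  | Box A => forall v, acc w v -> forces v A
  end.

Definition forces_all (M : model) (w : M) G := forall A, A \in G -> forces w A.

Definition forces_opt (M : model) (w : M) D :=
  if D is Some A then forces w A else False.

Definition holds (M : model) s :=
  forall w : M, forces_all w s.1 -> forces_opt w s.2.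

Definition valid s := forall M : model, holds M s.

(** Premises are assumed at all worlds of the model, since [RImp] and the modal rules are justified
    by moving to other worlds. *)
Definition sound C :=
  forall ps c, C ps c ->
  forall M : model, (forall s, s \in ps -> holds M s) -> holds M c.

Section Soundness.

Context (M : model).
Implicit Types u v w : M.

Lemma forces_mono A v w : le v w -> forces v A -> forces w A.
Proof.
elim: A v w => [|p|A IHA B IHB|A IHA B IHB|A _ B _|A _] v w vw //=.
- exact: val_mono.
- by case=> /(IHA _ _ vw) ? /(IHB _ _ vw).
- by case=> [/(IHA _ _ vw)|/(IHB _ _ vw)]; [left|right].
- by move=> AB u wu; apply: AB; apply: le_tr wu.
- by move=> bA u wu; apply: bA; apply: le_acc wu.
Qed.

Lemma forces_all_mono G v w : le v w -> forces_all v G -> forces_all w G.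
Proof. by move=> vw vG A /vG; apply: forces_mono. Qed.

Lemma forces_allD w G H :
  forces_all w (G `+` H) <-> forces_all w G /\ forces_all w H.
Proof.
split=> [wGH|[wG wH] A]; last by rewrite in_msetD => /orP[/wG|/wH].
by split=> A AG; apply: wGH; rewrite in_msetD AG ?orbT.
Qed.

Lemma forces_all1 w A : forces_all w [mset A] <-> forces w A.
Proof.
by split=> [|wA B]; [apply; apply: mset11|rewrite in_mset1 => /eqP ->].
Qed.

Lemma forces_all0 w : forces_all w mset0.
Proof. by move=> A; rewrite in_mset0. Qed.

Lemma forces_boxm w v G : forces_all w (boxm G) -> acc w v -> forces_all v G.
Proof. by move=> wG wv A; rewrite -mem_boxm => /wG/(_ _ wv). Qed.

(** The common core of all modal rules, by induction along converse accessibility: at an accessible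
    [v] the side formulas persist and [G] is unboxed. The diagonal [Box A] holds at [v] by
    induction, as worlds accessible from [v] are accessible from [w]. *)
Lemma forces_box S G A w :
  holds M (S `+` boxdot G `+` [mset Box A] =>> Some A) ->
  forces_all w S -> forces_all w (boxm G) -> forces w (Box A).
Proof.
move=> hA wS wG v; elim: v / (acc_wf v) => v _ IH wv.
apply: (hA v) => /=; rewrite !forces_allD forces_all1; split; last first.
  by move=> u vu; apply: IH => //; apply: le_acc vu; apply: acc_le.
split; first exact: forces_all_mono (acc_le wv) wS.
split; first exact: forces_boxm wG wv.
exact: forces_all_mono (acc_le wv) wG.
Qed.

End Soundness.

Lemma sound_calcU C C' : sound C -> sound C' -> sound (calcU C C').
Proof. by move=> sC sC' ps c [/sC|/sC']. Qed.

Lemma sound_common : sound common.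
Proof.
move=> ps c [] {ps c}.
- by move=> G p M _ w /=; rewrite forces_allD forces_all1 => -[].
- by move=> G D M _ w /=; rewrite forces_allD forces_all1 => -[[]].
- move=> G A B M /(@forall_mem2 (holds M))[hA hB] w wG.
  by split; [apply: hA|apply: hB].
- move=> G A B D M /(@forall_mem1 (holds M)) h w /=.
  rewrite forces_allD forces_all1.
  by move=> -[[wA wB] wG]; apply: (h w); rewrite /= !forces_allD !forces_all1.
- by move=> G A B M /(@forall_mem1 (holds M)) h w wG; left; apply: h.
- by move=> G A B M /(@forall_mem1 (holds M)) h w wG; right; apply: h.
- move=> G A B D M /(@forall_mem2 (holds M))[hA hB] w /=.
  rewrite forces_allD forces_all1 => -[[wA|wB] wG]; [apply: (hA w)|apply: (hB w)];
    by rewrite /= forces_allD forces_all1.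
- move=> G A B M /(@forall_mem1 (holds M)) h w wG v wv vA; apply: (h v).
  by rewrite /= forces_allD forces_all1; split=> //; apply: forces_all_mono wG.
Qed.

Lemma sound_LImp : sound LImp.
Proof.
move=> ps c [G A B D] M /(@forall_mem2 (holds M))[hA hB] w /= wABG.
apply: (hB w); move: (wABG); rewrite /= !forces_allD !forces_all1.
by case=> wAB wG; split=> //; apply: (wAB w (le_refl w)); apply: hA.
Qed.

Lemma sound_LAtomImp : sound LAtomImp.
Proof.
move=> ps c [G p A D] M /(@forall_mem1 (holds M)) h w /=.
rewrite !forces_allD !forces_all1 => -[wp [wpA wG]].
apply: (h w); rewrite /= !forces_allD !forces_all1.
by split=> //; split=> //; apply: (wpA w (le_refl w)).
Qed.

Lemma sound_LAndImp : sound LAndImp.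
Proof.
move=> ps c [G A B E D] M /(@forall_mem1 (holds M)) h w /=.
rewrite !forces_allD !forces_all1 => -[wABE wG].
apply: (h w); rewrite /= !forces_allD !forces_all1; split=> // v wv vA u vu uB.
by apply: wABE; [apply: le_tr vu|split=> //; apply: forces_mono vA].
Qed.

Lemma sound_LOrImp : sound LOrImp.
Proof.
move=> ps c [G A B E D] M /(@forall_mem1 (holds M)) h w /=.
rewrite !forces_allD !forces_all1 => -[wABE wG].
apply: (h w); rewrite /= !forces_allD !forces_all1.
by split; [|split=> //] => v wv vX; apply: wABE => //; [left|right].
Qed.

Lemma sound_LImpImp : sound LImpImp.
Proof.
move=> ps c [G A B E D] M /(@forall_mem2 (holds M))[hAB hE] w /=.
rewrite !forces_allD !forces_all1 => -[wABE wG].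
apply: (hE w); rewrite /= !forces_allD !forces_all1; split=> //.
apply: (wABE w (le_refl w)); apply: (hAB w).
rewrite /= !forces_allD !forces_all1; split=> // v wv vB.
(* [B] persists upwards, so it forces [Imp A B], and the nested implication then yields [E]. *)
by apply: wABE => // u vu _; apply: forces_mono vB.
Qed.

Lemma sound_R_SL : sound R_SL.
Proof.
move=> ps c [S P G A _] M /(@forall_mem1 (holds M)) h w /=; rewrite !forces_allD.
by move=> -[[_ wP] wG]; apply: forces_box h wP wG.
Qed.

Lemma sound_R4a_SL : sound R4a_SL.
Proof.
move=> ps c [S G A] M /(@forall_mem1 (holds M)) h w /=; rewrite !forces_allD.
by move=> -[wS wG]; apply: forces_box h wS wG.
Qed.

Lemma sound_Imp_SL : sound Imp_SL.
Proof.
move=> ps c [P G A B D _] M /(@forall_mem2 (holds M))[hA hB] w /=.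
rewrite !forces_allD !forces_all1 => -[[wP wG] wAB].
apply: (hB w); rewrite /= !forces_allD !forces_all1; split=> //.
apply: (wAB w (le_refl w)).
apply: (@forces_box _ (P `+` [mset Imp (Box A) B]) G) => //; last first.
  by rewrite forces_allD forces_all1.
by congr (holds M (_ =>> _)): hA; mset_ac.
Qed.

Lemma sound_R_GL : sound R_GL.
Proof.
move=> ps c [S G A] M /(@forall_mem1 (holds M)) h w /=.
rewrite !forces_allD => -[_ wG].
apply: (@forces_box _ mset0 G) => //; last exact: forces_all0.
by rewrite mset0D.
Qed.

Lemma sound_LBox : sound LBox.
Proof.
move=> ps c [G A D] M /(@forall_mem1 (holds M)) h w /=.
rewrite !forces_allD !forces_all1 => -[wA wG].
apply: (h w); rewrite /= !forces_allD !forces_all1; split=> // v /acc_le wv.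
exact: forces_mono wA.
Qed.

Lemma soundness C s : sound C -> derivable C s -> valid s.
Proof. by move=> sC ds M; elim: ds => ps c Cc _; apply: sC. Qed.

(** * Soundness of the Hilbert systems *)

Definition sound_axioms (Ax : axioms) :=
  forall A, Ax A -> forall (M : model) (w : M), forces w A.

Lemma sound_iK : sound_axioms iK_axiom.
Proof.
move=> _ [A B|A B E|A B|A B|A B|A B|A B|A B E|A|A B] M w v _ /=.
- by move=> vA u vu _; apply: forces_mono vA.
- move=> vABE u vu uAB t ut tA; apply: (vABE t (le_tr vu ut) tA t (le_refl t)).
  exact: uAB.
- by case.
- by case.
- by move=> vA u vu uB; split=> //; apply: forces_mono vA.
- by left.
- by right.
- move=> vAE u vu uBE t ut [tA|tB]; last exact: uBE.
  by apply: vAE tA; apply: le_tr ut.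
- by [].
- move=> vAB u vu uA t ut; apply: (vAB t _ t (le_refl t)); last exact: uA.
  exact: le_acc ut.
Qed.

Lemma sound_SL : sound_axioms SL_axiom.
Proof.
move=> _ [A] M w v _ /=; elim: v / (acc_wf v) => v _ IH vA.
apply: (vA v) (le_refl v) _ => u vu; apply: IH => // t ut.
by apply: vA; apply: le_tr ut; apply: acc_le.
Qed.

Lemma sound_GLC : sound_axioms GLC_axiom.
Proof.
move=> _ [A|A] M w v _ /=; last first.
  by move=> vA u /acc_le vu; apply: forces_mono vA.
move=> vA u; elim: u / (acc_wf u) => u _ IH vu.
apply: (vA u vu u (le_refl u)) => t ut; apply: IH => //.
by apply: le_acc ut; apply: acc_le.
Qed.

Lemma sound_axiomsU (Ax Ax' : axioms) :
  sound_axioms Ax -> sound_axioms Ax' -> sound_axioms (fun A => Ax A \/ Ax' A).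
Proof. by move=> sA sA' A [/sA|/sA']. Qed.

Lemma soundness_axioms (Ax : axioms) A :
  sound_axioms Ax -> provable Ax A -> valid (mset0 =>> Some A).
Proof.
move=> sA pA M w _ /=; elim: pA w => {A} [A /sA h w|A B _ IHAB _ IHA w|A _ IH w].
- exact: h.
- exact: (IHAB w w (le_refl w) (IHA w)).
- by move=> v _; apply: IH.
Qed.

(** * The canonical model *)

(* The products make the reductions of the left rules of G4im for implications
   strictly decreasing even for the sum of the weights of a context. *)
Fixpoint weight A : nat :=
  match A with
  | Bot | Atom _ => 2
  | And A B => weight A * weight B + 1
  | Or A B => weight A + weight B + 1
  | Imp A B => weight A * weight B
  | Box A => weight A + 1
  end.

Lemma weight_gt1 A : 1 < weight A.
Proof. by elim: A => //= *; nia. Qed.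

Definition mweight G : nat := \sum_(A <- G) weight A.

Lemma mweightD G H : mweight (G `+` H) = mweight G + mweight H.
Proof.
rewrite /mweight -big_cat; apply: perm_big.
by apply/allP=> A _ /=; rewrite count_cat !count_mem_mset msetE2.
Qed.

Lemma mweight1 A : mweight [mset A] = weight A.
Proof. by rewrite /mweight enum_msetn /= big_seq1. Qed.

Fixpoint boxes A : seq form :=
  match A with
  | Bot | Atom _ => [::]
  | And A B | Or A B | Imp A B => boxes A ++ boxes B
  | Box A => Box A :: boxes A
  end.

(* Saturation replaces principal formulas by lighter ones without keeping them;
   [gen G] recovers the replaced formulas. *)
Inductive gen G : form -> Prop :=
| gen_mem A : A \in G -> gen G A
| gen_and A B : gen G A -> gen G B -> gen G (And A B)
| gen_or1 A B : gen G A -> gen G (Or A B)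
| gen_or2 A B : gen G B -> gen G (Or A B)
| gen_imp A B : gen G B -> gen G (Imp A B)
| gen_and_imp A B E : gen G (Imp A (Imp B E)) -> gen G (Imp (And A B) E)
| gen_or_imp A B E :
    gen G (Imp A E) -> gen G (Imp B E) -> gen G (Imp (Or A B) E)
| gen_imp_imp A B E : gen G A -> gen G (Imp B E) -> gen G (Imp (Imp A B) E).

Definition gen_all G H := forall A, A \in H -> gen G A.

Lemma gen_all_trans G H A : gen_all G H -> gen H A -> gen G A.
Proof.
by move=> GH; elim=> {A} *;
  [apply: GH|apply: gen_and|apply: gen_or1|apply: gen_or2|apply: gen_imp
  |apply: gen_and_imp|apply: gen_or_imp|apply: gen_imp_imp].
Qed.

Lemma gen_all_refl G : gen_all G G.
Proof. by move=> A; apply: gen_mem. Qed.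

Lemma gen_allD X G H : gen_all X (G `+` H) <-> gen_all X G /\ gen_all X H.
Proof.
split=> [XGH|[XG XH] A]; last by rewrite in_msetD => /orP[/XG|/XH].
by split=> A AG; apply: XGH; rewrite in_msetD AG ?orbT.
Qed.

Lemma gen_all1 X A : gen_all X [mset A] <-> gen X A.
Proof. by split=> [|XA B]; [apply; apply: mset11|rewrite in_mset1 => /eqP ->]. Qed.

(** No constructor of [gen] but [gen_mem] yields an atom or a boxed formula. Saturation thus never
    loses these, and their membership can define the valuation and accessibility. *)
Lemma gen_Atom G p : gen G (Atom p) -> Atom p \in G.
Proof. by move=> g; inversion g. Qed.

Lemma gen_Box G A : gen G (Box A) -> Box A \in G.
Proof. by move=> g; inversion g. Qed.

Lemma count_lt (T : eqType) (a b : pred T) (r : seq T) x :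
  subpred a b -> x \in r -> b x -> ~~ a x -> count a r < count b r.
Proof.
move=> ab xr bx nax; elim: r xr => //= y r IH; rewrite inE.
have ab_y : a y <= b y by case: (boolP (a y)) => // /ab ->.
case: eqP => [<- _|_ /= /IH]; last by lia.
by rewrite bx (negPf nax) ltnS; apply: sub_count.
Qed.

Section Canonical.

Context (C : calculus) (L : seq form).

(** The left rules of G4im create implications that are not subformulas of the end sequent, but no
    new boxed subformulas. Bounding these alone is preserved, and is enough for converse
    well-foundedness. *)
Definition boxes_in G := forall A, A \in G -> {subset boxes A <= L}.

Lemma boxes_inD G H : boxes_in (G `+` H) <-> boxes_in G /\ boxes_in H.
Proof.
split=> [GH|[bG bH] A]; last by rewrite in_msetD => /orP[/bG|/bH].
by split=> A AG; apply: GH; rewrite in_msetD AG ?orbT.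
Qed.

Lemma boxes_in1 A : boxes_in [mset A] <-> {subset boxes A <= L}.
Proof. by split=> [|LA B]; [apply; apply: mset11|rewrite in_mset1 => /eqP ->]. Qed.

Lemma boxes_in_boxm G : boxes_in (boxm G) -> boxes_in G.
Proof.
move=> LG A AG B BA; apply: (LG (Box A)); first by rewrite mem_boxm.
by rewrite /= inE BA orbT.
Qed.

Definition minimal G D :=
  [/\ boxes_in G, ~ derivable C (G =>> D) &
      forall H, boxes_in H -> gen_all H G -> mweight H < mweight G ->
        derivable C (H =>> D)].

Lemma minimal_ext G D :
  boxes_in G -> ~ derivable C (G =>> D) ->
  exists2 H, minimal H D & gen_all H G.
Proof.
have [n] := ubnP (mweight G); elim: n G => // n IH G ltn LG nGD.
case: (classic (exists H, [/\ boxes_in H, gen_all H G, mweight H < mweight G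
    & ~ derivable C (H =>> D)])) => [[H [LH HG ltHG nHD]]|nH].
  have [|X minX XH] := IH H _ LH nHD; first by lia.
  by exists X => // A AG; apply: gen_all_trans XH (HG A AG).
exists G; last exact: gen_all_refl.
by split=> // H LH HG ltHG; apply: NNPP => nHD; apply: nH; exists H.
Qed.

(** The succedent [D] only witnesses minimality: the truth lemma refutes every formula underivable
    from [G] whose boxes lie in [L], not just [D]. *)
Definition cworld := {G : {mset form} | exists D, minimal G D}.

Implicit Types u v w : cworld.

(** Inclusion of contexts would be too strong: a lighter context may have dropped formulas that it
    still generates. *)
Definition cle w v := forall A, gen (sval w) A -> gen (sval v) A.

Definition cacc w v :=
  [/\ cle w v, forall A, Box A \in sval w -> gen (sval v) A &
      exists A, [/\ Box A \in L, Box A \notin sval w & Box A \in sval v]].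

Lemma cle_gen_all w v : gen_all (sval v) (sval w) -> cle w v.
Proof. by move=> vw A; apply: gen_all_trans. Qed.

Lemma cle_Box w v A : cle w v -> Box A \in sval w -> Box A \in sval v.
Proof. by move=> wv /gen_mem/wv/gen_Box. Qed.

Lemma cle_refl w : cle w w. Proof. by []. Qed.

Lemma cle_trans u v w : cle u v -> cle v w -> cle u w.
Proof. by move=> uv vw A /uv/vw. Qed.

Lemma cacc_le v w : cacc v w -> cle v w. Proof. by case. Qed.

Lemma cle_acc u v w : cle u v -> cacc v w -> cacc u w.
Proof.
move=> uv [vw bvw [A [AL Av Aw]]]; split; first exact: cle_trans vw.
  by move=> B /(cle_Box uv)/bvw.
by exists A; split=> //; apply: contra Av; apply: cle_Box.
Qed.

Lemma cacc_wf : well_founded (fun v w => cacc w v).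
Proof.
(* Restricted to boxed formulas, because only their absence is inherited downwards along [cle]. *)
pose missing w A := boxed A && (A \notin sval w).
apply: (Wf_nat.well_founded_lt_compat _ (fun w => count (missing w) L)).
move=> v w [wv _ [A [AL Aw Av]]]; apply/ltP.
apply: (@count_lt _ _ _ _ (Box A)) => //; last by rewrite /missing Av.
by case=> // B; apply: contra; apply: cle_Box.
Qed.

Lemma cval_mono p v w : cle v w -> Atom p \in sval v -> Atom p \in sval w.
Proof. by move=> vw /gen_mem/vw/gen_Atom. Qed.

Definition canonical : model :=
  Model cle_refl cle_trans cacc_le cle_acc cacc_wf cval_mono.

Definition truthful A := forall w : canonical,
  (gen (sval w) A -> forces w A) /\
  ({subset boxes A <= L} -> ~ derivable C (sval w =>> Some A) -> ~ forces w A).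

(* The only clause of the truth lemma that depends on the left rules for
   implication of the calculus. *)
Definition refutes_antecedents := forall (w : canonical) A B,
  Imp A B \in sval w -> (forall E, weight E < weight (Imp A B) -> truthful E) ->
  ~ forces w A.

Lemma world_boxes_in w : boxes_in (sval w).
Proof. by case: w => G [D []]. Qed.

Lemma world_ext w G A :
  boxes_in G -> ~ derivable C (G =>> Some A) -> gen_all G (sval w) ->
  exists v, [/\ cle w v, gen_all (sval v) G &
                ~ derivable C (sval v =>> Some A)].
Proof.
move=> LG nGA Gw; have [H minH HG] := minimal_ext LG nGA.
exists (exist _ H (ex_intro _ _ minH)); split=> //; last by case: minH.
by apply: cle_gen_all => B /Gw; apply: gen_all_trans.
Qed.

(** Meant for a [G] that is the left premise of a modal rule. Its diagonal formula [Box A] is the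
    new box that makes the step to [v] an accessibility step. *)
Lemma world_acc w G A :
  boxes_in G -> ~ derivable C (G =>> Some A) -> gen_all G (sval w) ->
  (forall B, Box B \in sval w -> B \in G) ->
  Box A \in G -> Box A \notin sval w ->
  exists2 v, cacc w v & ~ derivable C (sval v =>> Some A).
Proof.
move=> LG nGA Gw bGw AG Aw; have [v [wv vG nvA]] := world_ext LG nGA Gw.
exists v => //; split=> // [B /bGw/vG //|]; exists A; split=> //.
  by apply: LG AG _ _; rewrite /= inE eqxx.
exact/gen_Box/vG.
Qed.

(** * The truth lemma *)

Hypothesis common_C : forall ps c, common ps c -> C ps c.
Hypothesis R4_C : forall ps c, R4_SL ps c -> C ps c.
Hypothesis identity_C : forall A G, derivable C (A +` G =>> Some A).

Lemma derivable_common ps c :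
  common ps c -> (forall s, s \in ps -> derivable C s) -> derivable C c.
Proof. by move/common_C; apply: Infer. Qed.

Lemma derivable_mem G A : A \in G -> derivable C (G =>> Some A).
Proof. by case/mem_mset_split=> H ->; apply: identity_C. Qed.

Lemma world_Bot w : Bot \notin sval w.
Proof.
case: w => G [D [LG nGD _]] /=; apply/negP => /mem_mset_split[H eG]; apply: nGD.
by rewrite eG; apply: derivable_common (LBot _ _) _.
Qed.

(** Minimality replaces saturation: the premise of [LAnd] is lighter and generates the conjunction,
    so it would be derivable, and with it the world's own sequent. *)
Lemma world_And w A B : And A B \notin sval w.
Proof.
case: w => G [D [LG nGD minG]] /=; apply/negP => /mem_mset_split[H eG].
apply: nGD; rewrite eG; apply: derivable_common (LAnd _ _ _ _) _ => s.
move: LG; rewrite eG boxes_inD boxes_in1 /= => -[LAB LH].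
rewrite inE => /eqP ->; apply: minG; rewrite ?eG.
- rewrite !boxes_inD !boxes_in1; split; last split=> //.
    by move=> E EA; apply: LAB; rewrite mem_cat EA.
  by move=> E EA; apply: LAB; rewrite mem_cat EA orbT.
- have := @gen_all_refl (A +` (B +` H)).
  rewrite !gen_allD !gen_all1 => -[gA [gB gH]]; split=> //; exact: gen_and.
- rewrite !mweightD !mweight1 /=; have := weight_gt1 A; have := weight_gt1 B.
  by nia.
Qed.

Lemma world_Or w A B : Or A B \notin sval w.
Proof.
case: w => G [D [LG nGD minG]] /=; apply/negP => /mem_mset_split[H eG].
apply: nGD; rewrite eG; apply: derivable_common (LOr _ _ _ _) _ => s.
move: LG; rewrite eG boxes_inD boxes_in1 /= => -[LAB LH].
rewrite !inE => /orP[] /eqP ->; apply: minG; rewrite ?eG.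
- rewrite !boxes_inD !boxes_in1; split=> //.
  by move=> E EA; apply: LAB; rewrite mem_cat EA.
- have := @gen_all_refl (A +` H).
  by rewrite !gen_allD !gen_all1 => -[gA gH]; split=> //; exact: gen_or1.
- by rewrite !mweightD !mweight1 /=; lia.
- rewrite !boxes_inD !boxes_in1; split=> //.
  by move=> E EA; apply: LAB; rewrite mem_cat EA orbT.
- have := @gen_all_refl (B +` H).
  by rewrite !gen_allD !gen_all1 => -[gA gH]; split=> //; exact: gen_or2.
- by rewrite !mweightD !mweight1 /=; lia.
Qed.

Hypothesis imp_C : refutes_antecedents.

(** Follows the way in which the implication is generated. The reducts are lighter but need not be
    subformulas, hence induction on weight. For an implication in the context itself, the antecedent
    is not forced. *)
Lemma gen_forces_imp A B (w : canonical) :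
  (forall E, weight E < weight (Imp A B) -> truthful E) ->
  gen (sval w) (Imp A B) -> forces w A -> forces w B.
Proof.
move=> IH g wA; have := (weight_gt1 A, weight_gt1 B) => -[gtA gtB].
inversion g as [X ABw| | | |X Y gB|X Y Z gABE|X Y Z gAE gBE|X Y Z gA gBE]; subst.
- by case: (imp_C ABw IH wA).
- have [|h _] := IH B _ w; first by rewrite /=; nia.
  exact: h.
- case: wA => wX wY; have [|h _] := IH (Imp X (Imp Y B)) _ w.
    by rewrite /=; nia.
  exact: (h gABE w (le_refl w) wX w (le_refl w) wY).
- have := (weight_gt1 X, weight_gt1 Y) => -[gtX gtY].
  case: wA => [wX|wY].
    have [|h _] := IH (Imp X B) _ w; first by rewrite /=; nia.
    exact: (h gAE w (le_refl w) wX).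
  have [|h _] := IH (Imp Y B) _ w; first by rewrite /=; nia.
  exact: (h gBE w (le_refl w) wY).
- have := (weight_gt1 X, weight_gt1 Y) => -[gtX gtY].
  have ltXXY : weight X < weight X * weight Y by nia.
  have [|hX _] := IH X _ w; first by rewrite /=; nia.
  have [|hYB _] := IH (Imp Y B) _ w; first by rewrite /=; nia.
  exact: (hYB gBE w (le_refl w) (wA w (le_refl w) (hX gA))).
Qed.

Lemma truth A : truthful A.
Proof.
have [n] := ubnP (weight A); elim: n A => // n IHn A ltAn.
have {n ltAn IHn} IH E : weight E < weight A -> truthful E.
  by move=> ltEA; apply: IHn; lia.
move=> w; case: A IH => [|p|A B|A B|A B|A] /= IH.
- split=> [g|_ _ []]; inversion g; by have /negP := world_Bot w.
- split=> [/gen_Atom //|_ nwp wp]; apply: nwp; exact: derivable_mem.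
- have := (weight_gt1 A, weight_gt1 B) => -[gtA gtB].
  have [|gA dA] := IH A _ w; first by nia.
  have [|gB dB] := IH B _ w; first by nia.
  split.
    move=> g; inversion g; subst; last by auto.
    by have := world_And w A B; rewrite H.
  move=> LAB nAB [wA wB]; apply: nAB.
  apply: derivable_common (RAnd _ _ _) _ => s; rewrite !inE.
  case/orP=> /eqP ->; apply: NNPP.
    by move=> nA; apply: dA wA => // E EA; apply: LAB; rewrite mem_cat EA.
  by move=> nB; apply: dB wB => // E EB; apply: LAB; rewrite mem_cat EB orbT.
- have [|gA dA] := IH A _ w; first by lia.
  have [|gB dB] := IH B _ w; first by lia.
  split.
    move=> g; inversion g; subst; try by auto.
    by have := world_Or w A B; rewrite H.
  move=> LAB nAB wAB; apply: nAB; case: wAB => [wA|wB].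
    apply: derivable_common (ROr1 _ _ _) _ => s; rewrite inE => /eqP ->.
    apply: NNPP=> nA.
    by apply: dA wA => // E EA; apply: LAB; rewrite mem_cat EA.
  apply: derivable_common (ROr2 _ _ _) _ => s; rewrite inE => /eqP ->.
  apply: NNPP=> nB.
  by apply: dB wB => // E EA; apply: LAB; rewrite mem_cat EA orbT.
- split=> [g v wv vA|LAB nAB wAB].
    by apply: gen_forces_imp (wv _ g) vA.
  have := (weight_gt1 A, weight_gt1 B) => -[gtA gtB].
  have nAB' : ~ derivable C (A +` sval w =>> Some B).
    move=> dAB; apply: nAB; apply: derivable_common (RImp _ _ _) _ => s.
    by rewrite inE => /eqP ->.
  have [||v [wv vAw nvB]] := world_ext _ nAB' (w := w).
  + rewrite boxes_inD boxes_in1; split; last exact: world_boxes_in.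
    by move=> E EA; apply: LAB; rewrite mem_cat EA.
  + by have := @gen_all_refl (A +` sval w); rewrite gen_allD => -[].
  have /= ltA : weight A < weight (Imp A B) by rewrite /=; nia.
  have /= ltB : weight B < weight (Imp A B) by rewrite /=; nia.
  move: (vAw); rewrite gen_allD gen_all1 => -[/(proj1 (IH A ltA v)) vA _].
  apply: (proj2 (IH B ltB v)) nvB (wAB v wv vA).
  by move=> E EB; apply: LAB; rewrite mem_cat EB orbT.
- have ltA : weight A < weight A + 1 by lia.
  split=> [/gen_Box wA v [_ /(_ _ wA) vA _]|LA nA wA].
    exact: (proj1 (IH A ltA v)).
  (* The diagonal box is really new, as required for an accessible world. *)
  have Aw : Box A \notin sval w by apply/negP => /derivable_mem.
  have [P [G [uP eq_w]]] := boxm_split (sval w).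
  (* The premise of [R4_SL] for the context of [w]: it keeps all of that context, and [boxdot]
     supplies the unboxed formulas that accessible worlds must generate. *)
  pose X := P `+` boxdot G `+` [mset Box A].
  have nX : ~ derivable C (X =>> Some A).
    move=> dX; apply: nA; rewrite eq_w.
    apply: Infer (R4_C (R4_SL_intro _ _ uP)) _ => s.
    by rewrite inE => /eqP ->.
  have := @gen_all_refl X; rewrite /X !gen_allD gen_all1 => -[[gP [gG gbG]] gA].
  have [||||| v wv nvA] := world_acc (w := w) _ nX.
  + have := @world_boxes_in w.
    rewrite eq_w !boxes_inD boxes_in1 => -[LP LG].
    by split=> //; split=> //; split=> //; apply: boxes_in_boxm.
  + by rewrite eq_w gen_allD.
  + move=> B; rewrite eq_w in_msetD => /orP[/uP //|].
    by rewrite mem_boxm !in_msetD => ->; rewrite ?orbT.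
  + by rewrite in_msetD mset11 orbT.
  + exact: Aw.
  apply: (proj2 (IH A ltA v)) nvA (wA v wv).
  by move=> E EA; apply: LA; rewrite inE EA orbT.
Qed.

End Canonical.

Theorem completeness C s :
  (forall ps c, common ps c -> C ps c) ->
  (forall ps c, R4_SL ps c -> C ps c) ->
  (forall A G, derivable C (A +` G =>> Some A)) ->
  (forall L, @refutes_antecedents C L) ->
  valid s -> derivable C s.
Proof.
case: s => G D comC R4C idC impC vGD; apply: NNPP => nGD.
pose L := flatten (map boxes G) ++ (if D is Some A then boxes A else [::]).
have LG : boxes_in L G.
  move=> A AG B BA; rewrite mem_cat; apply/orP; left.
  by apply/flattenP; exists (boxes A) => //; apply: map_f.
have [H minH HG] := minimal_ext LG nGD.
pose w : canonical C L := exist _ H (ex_intro _ _ minH).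
have tr A := truth comC R4C idC (@impC L) A.
have wG : forces_all w G by move=> A /HG; apply: (proj1 (tr A w)).
have [_ nHD _] := minH; move: (vGD _ w wG) nHD => /=.
case eD: D => [A|] // wA nHA; apply: (proj2 (tr A w)) nHA wA.
by move=> B BA; rewrite mem_cat eD BA orbT.
Qed.

(** * Derivations in the calculi *)

Lemma infer0 C c : C [::] c -> derivable C c.
Proof. by move/Infer; apply. Qed.

Lemma infer1 C s1 c : C [:: s1] c -> derivable C s1 -> derivable C c.
Proof. by move=> Cc d1; apply: Infer Cc _ => s; rewrite inE => /eqP ->. Qed.

Lemma infer2 C s1 s2 c :
  C [:: s1; s2] c -> derivable C s1 -> derivable C s2 -> derivable C c.
Proof.
by move=> Cc d1 d2; apply: Infer Cc _ => s; rewrite !inE => /orP[]/eqP ->.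
Qed.

Lemma derivable_sub C C' s :
  (forall ps c, C ps c -> (forall r, r \in ps -> derivable C' r) ->
    derivable C' c) ->
  derivable C s -> derivable C' s.
Proof. by move=> CC'; elim=> ps c Cc _; apply: CC'. Qed.

(** The context [K] added to a premise may differ from [H]: [R4_SL] turns the boxed part of [H] into
    a [boxdot], and [R_GL] discards [H] altogether. *)
Definition weakenable C := forall ps c, C ps c -> forall H,
  exists2 ps', C ps' (H `+` c.1 =>> c.2) &
    forall r, r \in ps' -> exists2 s, s \in ps & exists K, r = (K `+` s.1 =>> s.2).

Lemma weakening C G D H :
  weakenable C -> derivable C (G =>> D) -> derivable C (H `+` G =>> D).
Proof.
move=> wC dG; rewrite -[G]/(G =>> D).1 -{2}[D]/(G =>> D).2.
elim: dG H => {G D} ps c Cc _ IH H; have [ps' Cc' ps'P] := wC _ _ Cc H.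
by apply: Infer Cc' _ => r /ps'P[s sps [K ->]]; apply: IH.
Qed.

Lemma weakenable_calcU C C' :
  weakenable C -> weakenable C' -> weakenable (calcU C C').
Proof.
move=> wC wC' ps c [/wC|/wC'] h H; have [ps' Cc ps'P] := h H; exists ps' => //.
  by left.
by right.
Qed.

Lemma weakenable0 C c : C [::] c -> exists2 ps', C ps' c &
  forall r, r \in ps' -> exists2 s, s \in [::] & exists K, r = (K `+` s.1 =>> s.2).
Proof. by exists [::]. Qed.

Lemma weakenable1 C G D c K : C [:: K `+` G =>> D] c -> exists2 ps', C ps' c &
  forall r, r \in ps' ->
    exists2 s, s \in [:: G =>> D] & exists K, r = (K `+` s.1 =>> s.2).
Proof.
move=> Cc; exists [:: K `+` G =>> D] => // r; rewrite inE => /eqP ->.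
by exists (G =>> D); [rewrite inE|exists K].
Qed.

Lemma weakenable2 C G D G' D' c K K' :
  C [:: K `+` G =>> D; K' `+` G' =>> D'] c -> exists2 ps', C ps' c &
  forall r, r \in ps' ->
    exists2 s, s \in [:: G =>> D; G' =>> D'] & exists K, r = (K `+` s.1 =>> s.2).
Proof.
move=> Cc; exists [:: K `+` G =>> D; K' `+` G' =>> D'] => // r.
rewrite !inE => /orP[] /eqP ->; [exists (G =>> D)|exists (G' =>> D')];
  by [rewrite !inE eqxx ?orbT|exists K|exists K'].
Qed.

Lemma weakenable_common : weakenable common.
Proof.
move=> ps c [] {ps c} /=.
- move=> G p H; rewrite msetDCA; exact: weakenable0 (At _ _).
- move=> G D H; rewrite msetDCA; exact: weakenable0 (LBot _ _).
- move=> G A B H; exact: weakenable2 (RAnd _ _ _).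
- move=> G A B D H; rewrite msetDCA; apply: (@weakenable1 _ _ _ _ H).
  by rewrite (msetDCA H) (msetDCA H); apply: LAnd.
- move=> G A B H; exact: weakenable1 (ROr1 _ _ _).
- move=> G A B H; exact: weakenable1 (ROr2 _ _ _).
- move=> G A B D H; rewrite msetDCA; apply: (@weakenable2 _ _ _ _ _ _ H H).
  by rewrite !(msetDCA H); apply: LOr.
- move=> G A B H; apply: (@weakenable1 _ _ _ _ H).
  by rewrite msetDCA; apply: RImp.
Qed.

Lemma weakenable_LImp : weakenable LImp.
Proof.
move=> ps c [G A B D] H /=; rewrite msetDCA.
apply: (@weakenable2 _ _ _ _ _ _ H H); rewrite !(msetDCA H); exact: LImp_intro.
Qed.

Lemma weakenable_LAtomImp : weakenable LAtomImp.
Proof.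
move=> ps c [G p A D] H /=; rewrite !(msetDCA H).
apply: (@weakenable1 _ _ _ _ H); rewrite !(msetDCA H); exact: LAtomImp_intro.
Qed.

Lemma weakenable_LAndImp : weakenable LAndImp.
Proof.
move=> ps c [G A B E D] H /=; rewrite !(msetDCA H).
apply: (@weakenable1 _ _ _ _ H); rewrite !(msetDCA H); exact: LAndImp_intro.
Qed.

Lemma weakenable_LOrImp : weakenable LOrImp.
Proof.
move=> ps c [G A B E D] H /=; rewrite !(msetDCA H).
apply: (@weakenable1 _ _ _ _ H); rewrite !(msetDCA H); exact: LOrImp_intro.
Qed.

Lemma weakenable_LImpImp' : weakenable LImpImp'.
Proof.
move=> ps c [G A B E D] H /=; rewrite !(msetDCA H).
apply: (@weakenable2 _ _ _ _ _ _ H H); rewrite !(msetDCA H).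
exact: LImpImp'_intro.
Qed.

Lemma weakenable_R4_SL : weakenable R4_SL.
Proof.
move=> ps c [P G A uP] H; have [P' [H' [uP' ->]]] := boxm_split H => /=.
apply: (@weakenable1 _ _ _ _ (P' `+` boxdot H')).
have := R4_SL_intro (G `+` H') A (unboxedD uP uP').
by congr (R4_SL [:: _ =>> _] (_ =>> _)); rewrite ?boxdotD ?boxmD; mset_ac.
Qed.

Lemma weakenable_Imp_SL : weakenable Imp_SL.
Proof.
move=> ps c [P G A B D uP] H; have [P' [H' [uP' ->]]] := boxm_split H => /=.
apply: (@weakenable2 _ _ _ _ _ _ (P' `+` boxdot H') (P' `+` boxm H')).
have := Imp_SL_intro (G `+` H') A B D (unboxedD uP uP').
by congr (Imp_SL [:: _ =>> _; _ =>> _] (_ =>> _));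
  rewrite ?boxdotD ?boxmD; mset_ac.
Qed.

Lemma weakenable_R_GL : weakenable R_GL.
Proof.
move=> ps c [S G A] H /=; rewrite msetDA; apply: (@weakenable1 _ _ _ _ mset0).
rewrite mset0D; exact: R_GL_intro.
Qed.

Lemma weakenable_LBox : weakenable LBox.
Proof.
move=> ps c [G A D] H /=; rewrite !(msetDCA H).
apply: (@weakenable1 _ _ _ _ H); rewrite !(msetDCA H); exact: LBox_intro.
Qed.

Lemma weakenable_G3iGLC : weakenable G3iGLC.
Proof.
by do ![apply: weakenable_calcU]; [apply: weakenable_common
  |apply: weakenable_LImp|apply: weakenable_R_GL|apply: weakenable_LBox].
Qed.

Lemma weakenable_G4iSL' : weakenable G4iSL'.
Proof.
by do ![apply: weakenable_calcU]; [apply: weakenable_common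
  |apply: weakenable_LAtomImp|apply: weakenable_LAndImp
  |apply: weakenable_LOrImp|apply: weakenable_LImpImp'
  |apply: weakenable_Imp_SL|apply: weakenable_R4_SL].
Qed.

(** With [Box A] counted among the boxed part of the conclusion, [boxdot] puts [A] into the premise,
    where identity for [A] applies. *)
Lemma identity_R4 C A G :
  (forall ps c, R4_SL ps c -> C ps c) ->
  (forall H, derivable C (A +` H =>> Some A)) ->
  derivable C (Box A +` G =>> Some (Box A)).
Proof.
move=> R4C idA; have [P [H [uP ->]]] := boxm_split G.
have -> : Box A +` (P `+` boxm H) = P `+` boxm (A +` H).
  by rewrite boxmD boxm1; mset_ac.
apply: infer1 (R4C _ _ (R4_SL_intro _ _ uP)) _.
rewrite (_ : _ `+` _ = A +` (P `+` boxm (A +` H) `+` H `+` [mset Box A])) //.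
by rewrite /boxdot; mset_ac.
Qed.

(** * Completeness of [G3iSL4] *)

Lemma common_G3iSL4 ps c : common ps c -> G3iSL4 ps c.
Proof. by move=> h; left; left. Qed.

Lemma R4_G3iSL4 ps c : R4_SL ps c -> G3iSL4 ps c.
Proof. by move=> h; right. Qed.

Lemma LImp_G3iSL4 ps c : LImp ps c -> G3iSL4 ps c.
Proof. by move=> h; left; right. Qed.

Lemma identity_G3iSL4 A G : derivable G3iSL4 (A +` G =>> Some A).
Proof.
elim: A G => [|p|A IHA B IHB|A IHA B IHB|A IHA B IHB|A IHA] G.
- exact: infer0 (common_G3iSL4 (LBot _ _)).
- exact: infer0 (common_G3iSL4 (At _ _)).
- apply: infer1 (common_G3iSL4 (LAnd _ _ _ _)) _.
  apply: infer2 (common_G3iSL4 (RAnd _ _ _)) (IHA _) _.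
  by rewrite msetDCA.
- apply: infer2 (common_G3iSL4 (LOr _ _ _ _)) _ _.
    exact: infer1 (common_G3iSL4 (ROr1 _ _ _)) (IHA _).
  exact: infer1 (common_G3iSL4 (ROr2 _ _ _)) (IHB _).
- apply: infer1 (common_G3iSL4 (RImp _ _ _)) _; rewrite msetDCA.
  apply: infer2 (LImp_G3iSL4 (LImp_intro _ _ _ _)) _ (IHB _).
  by rewrite msetDCA.
- exact: identity_R4 R4_G3iSL4 IHA.
Qed.

(** Supplies the premise in which [B] replaces the implication: it is lighter, and [gen_imp]
    recovers what was replaced. *)
Lemma minimal_imp C L A B G D :
  minimal C L (Imp A B +` G) D -> derivable C (B +` G =>> D).
Proof.
case=> LG _; apply.
- move: LG; rewrite !boxes_inD !boxes_in1 => -[LAB LG]; split=> //.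
  by move=> E EB; apply: LAB; rewrite mem_cat EB orbT.
- have := @gen_all_refl (B +` G); rewrite !gen_allD !gen_all1.
  by case=> gB gG; split=> //; apply: gen_imp.
- rewrite !mweightD !mweight1 /=.
  by have := (weight_gt1 A, weight_gt1 B) => -[gtA gtB]; nia.
Qed.

(** A forced antecedent is derivable from the world's context by the truth lemma for [A]. As [LImp]
    keeps the implication in its left premise, this is exactly that premise. *)
Lemma refutes_G3iSL4 L : @refutes_antecedents G3iSL4 L.
Proof.
move=> w A B ABw trE wA; have [D minD] := svalP w.
have [|_ dA] := trE A _ w.
  by have := (weight_gt1 A, weight_gt1 B) => -[gtA gtB]; rewrite /=; nia.
have {}dA : derivable G3iSL4 (sval w =>> Some A).
  apply: NNPP => nA; apply: dA nA wA => E EA.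
  by apply: (world_boxes_in ABw); rewrite /= mem_cat EA.
have [G eG] := mem_mset_split ABw; have [_ nD _] := minD; apply: nD.
move: minD dA; rewrite eG => minD dA.
exact: infer2 (LImp_G3iSL4 (LImp_intro _ _ _ _)) dA (minimal_imp minD).
Qed.

Theorem complete_G3iSL4 s : valid s -> derivable G3iSL4 s.
Proof.
exact: completeness common_G3iSL4 R4_G3iSL4 identity_G3iSL4 refutes_G3iSL4.
Qed.

(** * Completeness of [G4iSL'] *)

Lemma base_G4iSL' ps c : G4im_base ps c -> G4iSL' ps c.
Proof. by move=> h; left; left; left. Qed.

Lemma LImpImp'_G4iSL' ps c : LImpImp' ps c -> G4iSL' ps c.
Proof. by move=> h; left; left; right. Qed.

Lemma Imp_SL_G4iSL' ps c : Imp_SL ps c -> G4iSL' ps c.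
Proof. by move=> h; left; right. Qed.

Lemma R4_G4iSL' ps c : R4_SL ps c -> G4iSL' ps c.
Proof. by move=> h; right. Qed.

Lemma common_G4iSL' ps c : common ps c -> G4iSL' ps c.
Proof. by move=> h; apply: base_G4iSL'; left; left; left. Qed.

Lemma LAtomImp_G4iSL' ps c : LAtomImp ps c -> G4iSL' ps c.
Proof. by move=> h; apply: base_G4iSL'; left; left; right. Qed.

Lemma LAndImp_G4iSL' ps c : LAndImp ps c -> G4iSL' ps c.
Proof. by move=> h; apply: base_G4iSL'; left; right. Qed.

Lemma LOrImp_G4iSL' ps c : LOrImp ps c -> G4iSL' ps c.
Proof. by move=> h; apply: base_G4iSL'; right. Qed.

(* Without cut, identity and modus ponens need a simultaneous induction. *)
Lemma identity_mp_G4iSL' A :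
  (forall G, derivable G4iSL' (A +` G =>> Some A)) /\
  (forall E G D, derivable G4iSL' (E +` G =>> D) ->
    derivable G4iSL' (Imp A E +` (A +` G) =>> D)).
Proof.
have wk := weakening _ weakenable_G4iSL'.
elim: A => [|p|A [idA mpA] B [idB mpB]|A [idA mpA] B [idB mpB]
  |A [idA mpA] B [idB mpB]|A [idA mpA]]; split=> [G|E G D dE].
- exact: infer0 (common_G4iSL' (LBot _ _)).
- by rewrite msetDCA; apply: infer0 (common_G4iSL' (LBot _ _)).
- exact: infer0 (common_G4iSL' (At _ _)).
- rewrite msetDCA; apply: infer1 (LAtomImp_G4iSL' (LAtomImp_intro _ _ _ _)) _.
  exact: wk.
- apply: infer1 (common_G4iSL' (LAnd _ _ _ _)) _.
  apply: infer2 (common_G4iSL' (RAnd _ _ _)) (idA _) _.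
  by rewrite msetDCA.
- apply: infer1 (LAndImp_G4iSL' (LAndImp_intro _ _ _ _ _)) _.
  rewrite msetDCA; apply: infer1 (common_G4iSL' (LAnd _ _ _ _)) _.
  rewrite (_ : _ `+` _ = Imp A (Imp B E) +` (A +` (B +` G))); last by mset_ac.
  by apply/mpA/mpB.
- apply: infer2 (common_G4iSL' (LOr _ _ _ _)) _ _.
    exact: infer1 (common_G4iSL' (ROr1 _ _ _)) (idA _).
  exact: infer1 (common_G4iSL' (ROr2 _ _ _)) (idB _).
- apply: infer1 (LOrImp_G4iSL' (LOrImp_intro _ _ _ _ _)) _.
  rewrite (_ : _ `+` _ = Or A B +` (Imp A E +` (Imp B E +` G))); last by mset_ac.
  apply: infer2 (common_G4iSL' (LOr _ _ _ _)) _ _.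
    by rewrite msetDCA; apply: mpA; rewrite msetDCA; apply: wk.
  rewrite (_ : _ `+` _ = Imp B E +` (B +` (Imp A E +` G))); last by mset_ac.
  by apply: mpB; rewrite msetDCA; apply: wk.
- apply: infer1 (common_G4iSL' (RImp _ _ _)) _; rewrite msetDCA.
  exact: mpA.
- apply: infer2 (LImpImp'_G4iSL' (LImpImp'_intro _ _ _ _ _)) _ _.
    rewrite (_ : _ `+` _ = Imp A B +` (A +` (Imp B E +` G))); last by mset_ac.
    exact: mpA.
  by rewrite msetDCA; apply: wk.
- exact: identity_R4 R4_G4iSL' idA.
- have [P [H [uP eG]]] := boxm_split G; move: dE; rewrite {}eG => dE.
  have -> : Imp (Box A) E +` (Box A +` (P `+` boxm H)) =
      P `+` boxm (A +` H) `+` [mset Imp (Box A) E].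
    by rewrite boxmD boxm1; mset_ac.
  apply: infer2 (Imp_SL_G4iSL' (Imp_SL_intro _ _ _ _ uP)) _ _.
    rewrite (_ : _ `+` _ = A +` (P `+` H `+` boxm (A +` H) `+` [mset Box A]
      `+` [mset Imp (Box A) E])); first exact: idA.
    by rewrite /boxdot; mset_ac.
  rewrite (_ : _ `+` _ = Box A +` (E +` (P `+` boxm H))); first exact: wk.
  by rewrite boxmD boxm1; mset_ac.
Qed.

Lemma identity_G4iSL' A G : derivable G4iSL' (A +` G =>> Some A).
Proof. exact: (proj1 (identity_mp_G4iSL' A)). Qed.

(** One case per left rule, chosen by the shape of the antecedent. For conjunctions and disjunctions
    the implication cannot occur in a world, by minimality. For implications and boxes the
    underivable left premise yields another world, which refutes the antecedent. *)
Lemma refutes_G4iSL' L : @refutes_antecedents G4iSL' L.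
Proof.
move=> w A B ABw trE wA; have [D minD] := svalP w.
have [G eG] := mem_mset_split ABw.
have nD : ~ derivable G4iSL' (Imp A B +` G =>> D) by rewrite -eG; case: minD.
have LABG : boxes_in L (Imp A B +` G) by rewrite -eG; case: minD.
have dB : derivable G4iSL' (B +` G =>> D).
  by rewrite eG in minD; apply: minimal_imp minD.
have gtB := weight_gt1 B.
case: A => [|p|X Y|X Y|X Y|X] // in ABw trE wA eG nD LABG *.
- move: wA => /= ; rewrite eG in_mset1D => /orP[/eqP //|/mem_mset_split[H eH]].
  apply: nD; move: dB; rewrite eH msetDCA => dB; rewrite msetDCA.
  exact: infer1 (LAtomImp_G4iSL' (LAtomImp_intro _ _ _ _)) dB.
- apply: nD; apply: infer1 (LAndImp_G4iSL' (LAndImp_intro _ _ _ _ _)) _.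
  case: minD => _ _; apply; rewrite ?eG.
  + move: LABG; rewrite !boxes_inD !boxes_in1 /= => -[LXYB LG]; split=> //.
    by rewrite catA.
  + have := @gen_all_refl (Imp X (Imp Y B) +` G); rewrite !gen_allD !gen_all1.
    by case=> gXYB ?; split=> //; apply: gen_and_imp.
  + rewrite !mweightD !mweight1 /=; nia.
- apply: nD; apply: infer1 (LOrImp_G4iSL' (LOrImp_intro _ _ _ _ _)) _.
  case: minD => _ _; apply; rewrite ?eG.
  + move: LABG; rewrite !boxes_inD !boxes_in1 /= => -[LXYB LG].
    split; last split=> //; move=> E; rewrite mem_cat => EXY; apply: LXYB;
      rewrite !mem_cat; by case/orP: EXY => ->; rewrite ?orbT.
  + have := @gen_all_refl (Imp X B +` (Imp Y B +` G)).
    rewrite !gen_allD !gen_all1.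
    by case=> gXB [gYB ?]; split=> //; apply: gen_or_imp.
  + rewrite !mweightD !mweight1 /=; nia.
- have := (weight_gt1 X, weight_gt1 Y) => -[gtX gtY].
  have ltXXY : weight X < weight X * weight Y by nia.
  (* The left premise of [LImpImp']. It generates the context of [w] by [gen_imp_imp], so an
     extension lies above [w], forces [X] and refutes [Y]. *)
  pose Z := Imp Y B +` (X +` G).
  have nZ : ~ derivable G4iSL' (Z =>> Some Y).
    move=> dZ; apply: nD.
    exact: infer2 (LImpImp'_G4iSL' (LImpImp'_intro _ _ _ _ _)) dZ dB.
  move: LABG; rewrite !boxes_inD !boxes_in1 /= => -[LXYB LG].
  have [||v [wv vZ nY]] := world_ext (w := w) _ nZ.
  + rewrite !boxes_inD !boxes_in1 /=; split; last split=> //; move=> E EX;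
      apply: LXYB; rewrite !mem_cat; last by rewrite EX.
    by move: EX; rewrite mem_cat => /orP[] ->; rewrite ?orbT.
  + have := @gen_all_refl Z; rewrite eG !gen_allD !gen_all1.
    by case=> ? [? ?]; split=> //; apply: gen_imp_imp.
  move: vZ; rewrite !gen_allD !gen_all1 => -[_ [gX _]].
  have [|/(_ gX) vX _] := trE X _ v; first by rewrite /=; nia.
  have [|_ nvY] := trE Y _ v; first by rewrite /=; nia.
  apply: nvY nY (wA v wv vX) => E EY.
  by apply: LXYB; rewrite !mem_cat EY orbT.
- have [P [H [uP eH]]] := boxm_split G.
  pose Z := P `+` boxdot H `+` [mset Box X] `+` [mset Imp (Box X) B].
  have nZ : ~ derivable G4iSL' (Z =>> Some X).
    move=> dZ; apply: nD; rewrite eH msetDC.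
    apply: infer2 (Imp_SL_G4iSL' (Imp_SL_intro _ _ _ _ uP)) dZ _.
    by rewrite msetDC -eH.
  have eq_w : sval w = P `+` boxm H `+` [mset Imp (Box X) B].
    by rewrite eG eH msetDC.
  (* Otherwise [X] would be among [H], hence in [Z] through [boxdot], and identity would derive [X]
     from [Z]. *)
  have Xw : Box X \notin sval w.
    rewrite eq_w !in_msetD in_mset1 mem_boxm !negb_or.
    apply/andP; split=> //; apply/andP; split; first by apply/negP => /uP.
    apply/negP => /mem_mset_split[K eK]; apply: nZ.
    rewrite (_ : Z = X +` (P `+` K `+` boxm H `+` [mset Box X]
      `+` [mset Imp (Box X) B])); first exact: identity_G4iSL'.
    by rewrite /Z /boxdot {1}eK; mset_ac.
  have := @gen_all_refl Z.
  rewrite /Z !gen_allD !gen_all1 => -[[[gP [gH gbH]] gX] gXB].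
  have [||||| v wv nX] := world_acc (w := w) _ nZ.
  + move: LABG; rewrite eH !boxes_inD !boxes_in1 => -[LXB [LP LH]].
    split=> //; split; last by move=> E EX; apply: LXB; rewrite mem_cat EX.
    by split=> //; split=> //; apply: boxes_in_boxm.
  + by rewrite eq_w !gen_allD gen_all1.
  + move=> E; rewrite eq_w /Z !in_msetD in_mset1 mem_boxm.
    by case/orP=> [/orP[/uP //|->]|/eqP //]; rewrite ?orbT.
  + by rewrite /Z !in_msetD mset11 !orbT.
  + exact: Xw.
  have [|_ nvX] := trE X _ v; first by rewrite /=; nia.
  apply: nvX nX (wA v wv) => E EX; apply: (LABG (Imp (Box X) B)).
    exact: mset1D1.
  by rewrite /= inE mem_cat EX orbT.
Qed.

Theorem complete_G4iSL' s : valid s -> derivable G4iSL' s.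
Proof.
exact: completeness common_G4iSL' R4_G4iSL' identity_G4iSL' refutes_G4iSL'.
Qed.

(** * Inclusions between the calculi *)

Lemma derivable_rules C C' s :
  (forall ps c, C ps c -> C' ps c) -> derivable C s -> derivable C' s.
Proof. by move=> CC'; apply: derivable_sub => ps c /CC'; apply: Infer. Qed.

Lemma R4_SL_R4a_SL ps c : R4_SL ps c -> R4a_SL ps c.
Proof. by case=> P G A _; apply: R4a_SL_intro. Qed.

Lemma R4_SL_R_SL ps c : R4_SL ps c -> R_SL ps c.
Proof.
by case=> P G A uP; have := R_SL_intro mset0 G A uP; rewrite boxm0 mset0D.
Qed.

Lemma G3iSL4_G3iSLa s : derivable G3iSL4 s -> derivable G3iSLa s.
Proof.
by apply: derivable_rules => ps c [h|/R4_SL_R4a_SL h]; [left|right].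
Qed.

Lemma G3iSL4_G3iSL s : derivable G3iSL4 s -> derivable G3iSL s.
Proof. by apply: derivable_rules => ps c [h|/R4_SL_R_SL h]; [left|right]. Qed.

(** An application of [RImp] turns the left premise of [LImpImp'] into that of [LImpImp]. *)
Lemma G4iSL'_G4iSL s : derivable G4iSL' s -> derivable G4iSL s.
Proof.
apply: derivable_sub => ps c [[[h|[G A B E D]]|h]|h] IH.
- by apply: Infer IH; left; left; left.
- have [dB dE] := forall_mem2 IH.
  apply: infer2 _ _ dE; first by left; left; right; apply: LImpImp_intro.
  apply: infer1 dB; do 6! left; rewrite msetDCA; exact: RImp.
- by apply: Infer IH; left; right.
- by apply: Infer IH; right.
Qed.

Lemma G4iSL_G4iSLa s : derivable G4iSL s -> derivable G4iSLa s.
Proof.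
by apply: derivable_rules => ps c [h|/R4_SL_R4a_SL h]; [left|right].
Qed.

Lemma G3iGLC_boxm P G D :
  derivable G3iGLC (boxm P `+` G =>> D) -> derivable G3iGLC (P `+` G =>> D).
Proof.
rewrite -{2}(seq_mset_id P) /boxm; elim: (P : seq form) G => [|A r IH] G /=.
  by have -> : seq_mset [::] = mset0 :> {mset form}
    by apply/msetP=> B; rewrite mset_seqE mset0E.
rewrite !mset_cons -!msetDA msetDCA => dG.
apply: (@infer1 _ (Box A +` (seq_mset r `+` G) =>> D)).
  by right; apply: LBox_intro.
by rewrite msetDCA; apply: IH.
Qed.

(* [LBox] boxes the side formulas of [R4_SL], which [R_GL] would discard. *)
Lemma G3iSL4_G3iGLC s : derivable G3iSL4 s -> derivable G3iGLC s.
Proof.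
apply: derivable_sub => ps c [h|[P G A uP]] IH.
  by apply: Infer IH; left; left.
apply: G3iGLC_boxm; rewrite -boxmD -[boxm _]mset0D.
apply: infer1; first by left; right; apply: R_GL_intro.
(* [R_GL] is applied with [P] among its boxed formulas, so its premise also contains [boxm P], which
   weakening adds. *)
have /(weakening (boxm P) weakenable_G3iGLC) := forall_mem1 IH.
rewrite (_ : _ `+` _ = boxdot (P `+` G) `+` [mset Box A]) //.
by rewrite boxdotD /boxdot; mset_ac.
Qed.

(** * The Hilbert systems *)

(** Necessitation applies only to theorems, inside [ent_thm]; this is what makes the deduction
    theorem hold. *)
Inductive entails (Ax : axioms) G : form -> Prop :=
| ent_thm A : provable Ax A -> entails Ax G A
| ent_hyp A : A \in G -> entails Ax G A
| ent_mp A B : entails Ax G (Imp A B) -> entails Ax G A -> entails Ax G B.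

Definition ent_seq (Ax : axioms) s := entails Ax s.1 (odflt Bot s.2).

Section Entails.

Context (Ax : axioms) (iK_Ax : forall A, iK_axiom A -> Ax A).

Local Notation "G |- A" := (entails Ax G A) (at level 70, no associativity).

Lemma ent_iK G A : iK_axiom A -> G |- A.
Proof. by move=> /iK_Ax/prov_ax; apply: ent_thm. Qed.

Lemma ent_mp2 G A B E : G |- Imp A (Imp B E) -> G |- A -> G |- B -> G |- E.
Proof. by move=> gABE /(ent_mp gABE); apply: ent_mp. Qed.

Lemma ent_id G A : G |- Imp A A.
Proof.
apply: ent_mp2 (ent_iK _ (ax_s A (Imp A A) A)) _ _; exact/ent_iK/ax_k.
Qed.

Lemma deduction G A B : A +` G |- B -> G |- Imp A B.
Proof.
elim=> {B} [B pB|B|B E _ IHBE _ IHB].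
- exact: ent_mp (ent_iK _ (ax_k _ _)) (ent_thm _ pB).
- rewrite in_mset1D => /predU1P[->|BG]; first exact: ent_id.
  exact: ent_mp (ent_iK _ (ax_k _ _)) (ent_hyp _ BG).
- exact: ent_mp2 (ent_iK _ (ax_s _ _ _)) IHBE IHB.
Qed.

Lemma ent_cut G H A : H |- A -> (forall B, B \in H -> G |- B) -> G |- A.
Proof.
move=> HA GH; elim: HA => [B pB|B BH|B E _ GBE _ GB].
- exact: ent_thm.
- exact: GH.
- exact: ent_mp GBE GB.
Qed.

Lemma ent_sub G H A : {subset H <= G} -> H |- A -> G |- A.
Proof. by move=> HG /ent_cut; apply=> B /HG; apply: ent_hyp. Qed.

Lemma ent_head G A : A +` G |- A.
Proof. exact/ent_hyp/mset1D1. Qed.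

Lemma ent_weak G A B : G |- B -> A +` G |- B.
Proof. by apply: ent_sub => E EG; rewrite in_mset1D EG orbT. Qed.

Lemma ent0 A : mset0 |- A -> provable Ax A.
Proof.
elim=> // [B|B E _ pBE _ pB]; [by rewrite in_mset0|exact: prov_mp pBE pB].
Qed.

Lemma ent_box G H A :
  H |- A -> (forall B, B \in H -> G |- Box B) -> G |- Box A.
Proof.
move=> HA GH; elim: HA => [B pB|B BH|B E _ GBE _ GB].
- exact/ent_thm/prov_nec.
- exact: GH.
- exact: ent_mp2 (ent_iK _ (ax_box_imp _ _)) GBE GB.
Qed.

Lemma ent_common ps c : common ps c ->
  (forall s, s \in ps -> ent_seq Ax s) -> ent_seq Ax c.
Proof.
case=> {ps c}; rewrite /ent_seq /=.
- by move=> G p _; apply: ent_head.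
- move=> G D _; apply: ent_mp (ent_head _ _); exact/ent_iK/ax_bot_elim.
- move=> G A B /(@forall_mem2 (ent_seq Ax))[/= dA dB].
  exact: ent_mp2 (ent_iK _ (ax_and_intro _ _)) dA dB.
- move=> G A B D /(@forall_mem1 (ent_seq Ax)) /=; move/deduction/deduction=> dAB.
  have AB := ent_head G (And A B).
  apply: ent_mp2 (ent_weak _ _) _ _; last 2 first.
  + exact: ent_mp (ent_iK _ (ax_and_elim2 _ _)) AB.
  + exact: ent_mp (ent_iK _ (ax_and_elim1 _ _)) AB.
  + exact: dAB.
- move=> G A B /(@forall_mem1 (ent_seq Ax)).
  exact: ent_mp (ent_iK _ (ax_or_intro1 _ _)).
- move=> G A B /(@forall_mem1 (ent_seq Ax)).
  exact: ent_mp (ent_iK _ (ax_or_intro2 _ _)).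
- move=> G A B D /(@forall_mem2 (ent_seq Ax))[/deduction dA /deduction dB].
  apply: ent_mp (ent_head _ _); apply: ent_weak.
  exact: ent_mp2 (ent_iK _ (ax_or_elim _ _ _)) dA dB.
- by move=> G A B /(@forall_mem1 (ent_seq Ax))/deduction.
Qed.

Lemma ent_LImp ps c : LImp ps c ->
  (forall s, s \in ps -> ent_seq Ax s) -> ent_seq Ax c.
Proof.
case=> G A B D /(@forall_mem2 (ent_seq Ax))[/= dA /deduction dB].
by apply: ent_mp (ent_weak _ dB) _; apply: ent_mp (ent_head _ _) dA.
Qed.

End Entails.

Lemma iK_iHSL A : iK_axiom A -> iHSL A. Proof. by left. Qed.

Lemma iK_iHGLC A : iK_axiom A -> iHGLC A. Proof. by left. Qed.

(** The axiom is instantiated at [B], the conjunction of [A] and [Box A]. Under the hypothesis [A],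
    [Box B] gives [Box A] and hence [B]; so [B] follows, and with it [Box A]. *)
Lemma iHSL_C A : provable iHSL (Imp A (Box A)).
Proof.
apply: (ent0 (deduction iK_iHSL _)).
pose B := And A (Box A).
apply: (@ent_mp _ _ B); first exact/(ent_iK iK_iHSL)/ax_and_elim2.
apply: (@ent_mp _ _ (Imp (Box B) B)).
  by apply/ent_thm/prov_ax; right; apply: ax_SL.
apply: (deduction iK_iHSL); apply: (ent_mp2 (A := A) (B := Box A)).
- exact/(ent_iK iK_iHSL)/ax_and_intro.
- exact/ent_weak/ent_head.
apply: (ent_box iK_iHSL (H := [mset B]) (A := A)).
  apply: (@ent_mp _ _ B); first exact/(ent_iK iK_iHSL)/ax_and_elim1.
  exact/ent_hyp/mset11.
by move=> E; rewrite in_mset1 => /eqP ->; apply: ent_head.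
Qed.

Lemma iHSL_GL A : provable iHSL (Imp (Box (Imp (Box A) A)) (Box A)).
Proof.
apply: (prov_mp (A := Box (Imp (Imp (Box A) A) A))).
  exact/prov_ax/iK_iHSL/ax_box_imp.
by apply/prov_nec/prov_ax; right; apply: ax_SL.
Qed.

(** For [R4_SL], deduction turns the premise into a derivation of [Imp (Box A) A]. Boxing it needs
    every side formula boxed: members of [G] are boxed in the conclusion, those of [P] and [boxm G]
    by [iHSL_C]. Löb's scheme then yields [Box A]. *)
Lemma G3iSL4_iHSL s :
  derivable G3iSL4 s -> ent_seq iHSL s.
Proof.
elim=> {s} ps c [[h|h]|[P G A uP]] _ IH.
- exact: (ent_common iK_iHSL) h IH.
- exact: (ent_LImp iK_iHSL) h IH.
have /= := forall_mem1 IH; rewrite msetDC => /(deduction iK_iHSL) dA.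
apply: ent_mp (ent_thm _ (iHSL_GL A)) _; apply: (ent_box iK_iHSL) dA _ => B.
rewrite !in_msetD => /or3P[BP|BG|BG].
- apply: ent_mp (ent_thm _ (iHSL_C B)) _.
  by apply: ent_hyp; rewrite in_msetD BP.
- by apply: ent_hyp; rewrite in_msetD mem_boxm BG orbT.
- apply: ent_mp (ent_thm _ (iHSL_C B)) _.
  by apply: ent_hyp; rewrite in_msetD BG orbT.
Qed.

(** [ax_C] boxes the hypothesis [Imp (Box A) A], [ax_GL] then gives [Box A], and the hypothesis
    itself gives [A]. *)
Lemma iHGLC_SL A : provable iHGLC (Imp (Imp (Box A) A) A).
Proof.
apply: (ent0 (deduction iK_iHGLC _)); apply: ent_mp (ent_head _ _ _) _.
apply: (@ent_mp _ _ (Box (Imp (Box A) A))).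
  by apply/ent_thm/prov_ax; right; apply: ax_GL.
apply: ent_mp (ent_head _ _ _).
by apply/ent_thm/prov_ax; right; apply: ax_C.
Qed.

Lemma iHSL_iHGLC A : provable iHSL A -> provable iHGLC A.
Proof.
elim=> {A} [A [h|[] /=]|A B _ pAB _ pA|A _ pA].
- exact/prov_ax/iK_iHGLC.
- exact: iHGLC_SL.
- exact: prov_mp pAB pA.
- exact: prov_nec.
Qed.

(** * Validity as the pivot of all equivalences *)

Definition semantic (X : proof_system) : Prop :=
  match X with
  | Gentzen C => forall s, derivable C s <-> valid s
  | Hilbert Ax => forall A, provable Ax A <-> valid (mset0 =>> Some A)
  end.

Lemma semantic_equivalent X Y : semantic X -> semantic Y -> equivalent X Y.
Proof.
case: X => [C|Ax]; case: Y => [C'|Ax'] /= hX hY.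
- by move=> s; rewrite hX hY.
- by move=> A; rewrite hX hY.
- by move=> A; rewrite hX hY.
- by move=> A; rewrite hX hY.
Qed.

Lemma sound_G3im : sound G3im.
Proof. exact: sound_calcU sound_common sound_LImp. Qed.

Lemma sound_G4iSLa : sound G4iSLa.
Proof.
by do ![apply: sound_calcU]; [apply: sound_common|apply: sound_LAtomImp
  |apply: sound_LAndImp|apply: sound_LOrImp|apply: sound_LImpImp
  |apply: sound_Imp_SL|apply: sound_R4a_SL].
Qed.

Lemma sound_G3iSLa s : derivable G3iSLa s -> valid s.
Proof. exact/soundness/(sound_calcU sound_G3im)/sound_R4a_SL. Qed.

Lemma semantic_G4 C :
  (forall s, derivable G4iSL' s -> derivable C s) ->
  (forall s, derivable C s -> derivable G4iSLa s) -> semantic (Gentzen C).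
Proof.
move=> sC Cs s; split=> [/Cs/(soundness sound_G4iSLa) //|].
by move/complete_G4iSL'/sC.
Qed.

Lemma semantic_G3 C :
  (forall s, derivable G3iSL4 s -> derivable C s) ->
  (forall s, derivable C s -> valid s) -> semantic (Gentzen C).
Proof. by move=> sC Cs s; split=> [/Cs|/complete_G3iSL4/sC]. Qed.

Lemma semantic_Hilbert (Ax : axioms) :
  (forall A, provable iHSL A -> provable Ax A) -> sound_axioms Ax ->
  semantic (Hilbert Ax).
Proof.
move=> sAx sound_Ax A; split=> [|/complete_G3iSL4/G3iSL4_iHSL/ent0/sAx //].
exact: soundness_axioms.
Qed.

Theorem corollary5 (X Y : proof_system) :
  let systems :=
    [:: Gentzen G3iSL; Gentzen G3iSLa; Gentzen G3iSL4; Gentzen G4iSL;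
        Gentzen G4iSL'; Gentzen G4iSLa; Gentzen G3iGLC;
        Hilbert iHSL; Hilbert iHGLC] in
  List.In X systems -> List.In Y systems -> equivalent X Y.
Proof.
move=> systems.
suff sem Z : List.In Z systems -> semantic Z.
  by move=> /sem hX /sem hY; apply: semantic_equivalent.
do ![case=> [<-|]].
- apply: semantic_G3 G3iSL4_G3iSL _ => s.
  exact/soundness/(sound_calcU sound_G3im)/sound_R_SL.
- exact: semantic_G3 G3iSL4_G3iSLa sound_G3iSLa.
- by apply: semantic_G3 => // s /G3iSL4_G3iSLa/sound_G3iSLa.
- exact: semantic_G4 G4iSL'_G4iSL G4iSL_G4iSLa.
- by apply: semantic_G4 => // s /G4iSL'_G4iSL/G4iSL_G4iSLa.
- by apply: semantic_G4 => // s /G4iSL'_G4iSL/G4iSL_G4iSLa.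
- apply: semantic_G3 G3iSL4_G3iGLC _ => s; apply: soundness.
  exact: sound_calcU (sound_calcU sound_G3im sound_R_GL) sound_LBox.
- by apply: semantic_Hilbert; last exact: sound_axiomsU sound_iK sound_SL.
- apply: semantic_Hilbert iHSL_iHGLC _.
  exact: sound_axiomsU sound_iK sound_GLC.
Qed.
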